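(* Let $\mathcal{C}$ be a category with finite products and weak equalisers. Then the exact completion $\mathcal{C}_{ex}$ is elemental if and only if every object of $\mathcal{C}$ is a choice object.
   Context: A weak limit is defined like a limit but without uniqueness of the mediating arrow. Global elements: an arrow $x\colon 1\to X$ is written $x\in X$. For $f\colon X\to Y$ and $y\in Y$, write $y\in_f$ if there is $x\in X$ with $fx=y$; $f$ is surjective if $y\in_f$ for all $y\in Y$. An object $Y$ is a choice object if every surjection with codomain $Y$ has a section. The terminal object is a strong generator if every arrow $f\colon X\to Y$ such that for every $y\in Y$ there is a unique $x\in X$ with $fx=y$ is an isomorphism; it is separating if any two arrows $f,g\colon X\to Y$ with $fx=gx$ for all $x\in X$ are equal. A category with a terminal object is elemental if its terminal object is a strong generator and separating. Exact completion: a pseudo-equivalence relation on $X$ in $\mathcal{C}$ is an arrow $r=\langle r_1,r_2\rangle\colon R\to X\times X$ for which there exist (not necessarily unique) arrows $\rho\colon X\to R$ with $r\rho=\langle 1_X,1_X\rangle$, $\sigma\colon R\to R$ with $r\sigma=\langle r_2,r_1\rangle$, and $\tau\colon Q\to R$ with $r\tau=\langle r_1p_1,r_2p_2\rangle$, where $(Q,p_1,p_2)$ is a weak pullback of $r_2$ and $r_1$. The category $\mathcal{C}_{ex}$ has as objects the pseudo-equivalence relations of $\mathcal{C}$; an arrow from $r\colon R\to X\times X$ to $s\colon S\to Y\times Y$ is an equivalence class $[f]$ of arrows $f\colon X\to Y$ of $\mathcal{C}$ for which some $\hat f\colon R\to S$ satisfies $s\hat f=(f\times f)r$, where $f,g$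 are identified when some $h\colon X\to S$ satisfies $sh=\langle f,g\rangle$; composition is induced by that of $\mathcal{C}$. *)

(* Defs.v *)
From Stdlib Require Import FunctionalExtensionality PropExtensionality ProofIrrelevance.

Set Implicit Arguments.
Unset Strict Implicit.
Unset Printing Implicit Defensive.

Declare Scope cat_scope.
Delimit Scope cat_scope with cat.
Local Open Scope cat_scope.

Record Category := {
  ob :> Type;
  hom : ob -> ob -> Type;
  idm : forall X, hom X X;
  comp : forall X Y Z, hom Y Z -> hom X Y -> hom X Z;
  comp_idl : forall X Y (f : hom X Y), comp (idm Y) f = f;
  comp_idr : forall X Y (f : hom X Y), comp f (idm X) = f;
  comp_assoc : forall X Y Z W (h : hom Z W) (g : hom Y Z) (f : hom X Y),
    comp h (comp g f) = comp (comp h g) f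
}.

Arguments hom {_} _ _.
Arguments idm {_} _.
Arguments comp {_ X Y Z} _ _.

Notation "g ∘ f" := (comp g f) (at level 40, left associativity) : cat_scope.

Definition is_iso (C : Category) (X Y : C) (f : hom X Y) : Prop :=
  exists g : hom Y X, g ∘ f = idm X /\ f ∘ g = idm Y.

Definition is_section (C : Category) (X Y : C) (f : hom X Y) (s : hom Y X) : Prop :=
  f ∘ s = idm Y.

Definition is_terminal (C : Category) (T : C) : Prop :=
  forall X : C, exists! f : hom X T, True.

Record FiniteProducts (C : Category) := {
  one : C;
  one_terminal : is_terminal one;
  prod : C -> C -> C;
  pi1 : forall X Y, hom (prod X Y) X;
  pi2 : forall X Y, hom (prod X Y) Y;
  pair : forall Z X Y, hom Z X -> hom Z Y -> hom Z (prod X Y);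
  pi1_pair : forall Z X Y (f : hom Z X) (g : hom Z Y), pi1 X Y ∘ pair f g = f;
  pi2_pair : forall Z X Y (f : hom Z X) (g : hom Z Y), pi2 X Y ∘ pair f g = g;
  pair_unique : forall Z X Y (h : hom Z (prod X Y)),
    h = pair (pi1 X Y ∘ h) (pi2 X Y ∘ h)
}.

Arguments one {C} _.
Arguments prod {C} _ _ _.
Arguments pi1 {C} _ {X Y}.
Arguments pi2 {C} _ {X Y}.
Arguments pair {C} _ {Z X Y} _ _.

Definition prod_map (C : Category) (P : FiniteProducts C) (X Y X' Y' : C)
    (f : hom X X') (g : hom Y Y') : hom (prod P X Y) (prod P X' Y') :=
  pair P (f ∘ pi1 P) (g ∘ pi2 P).

Definition is_weak_equaliser (C : Category) (X Y : C) (f g : hom X Y)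
    (E : C) (e : hom E X) : Prop :=
  f ∘ e = g ∘ e /\
  forall (Z : C) (z : hom Z X), f ∘ z = g ∘ z -> exists u : hom Z E, e ∘ u = z.

Definition has_weak_equalisers (C : Category) : Prop :=
  forall (X Y : C) (f g : hom X Y),
    exists (E : C) (e : hom E X), is_weak_equaliser f g e.

Definition is_weak_pullback (C : Category) (X Y Z : C) (f : hom X Z) (g : hom Y Z)
    (Q : C) (p1 : hom Q X) (p2 : hom Q Y) : Prop :=
  f ∘ p1 = g ∘ p2 /\
  forall (W : C) (a : hom W X) (b : hom W Y), f ∘ a = g ∘ b ->
    exists u : hom W Q, p1 ∘ u = a /\ p2 ∘ u = b.

(* In the following definitions [T] is meant to be a terminal object, so that
   [hom T X] is the collection of global elements of [X]. *)

Definition in_image (C : Category) (T X Y : C) (f : hom X Y) (y : hom T Y) : Prop :=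
  exists x : hom T X, f ∘ x = y.

Definition surjective (C : Category) (T X Y : C) (f : hom X Y) : Prop :=
  forall y : hom T Y, in_image f y.

Definition choice_object (C : Category) (T Y : C) : Prop :=
  forall (X : C) (f : hom X Y), surjective T f -> exists s : hom Y X, is_section f s.

Definition strong_generator (C : Category) (T : C) : Prop :=
  forall (X Y : C) (f : hom X Y),
    (forall y : hom T Y, exists! x : hom T X, f ∘ x = y) -> is_iso f.

Definition separating (C : Category) (T : C) : Prop :=
  forall (X Y : C) (f g : hom X Y),
    (forall x : hom T X, f ∘ x = g ∘ x) -> f = g.

Definition elemental (C : Category) : Prop :=
  exists T : C, is_terminal T /\ strong_generator T /\ separating T.

Definition is_pseudo_equivalence (C : Category) (P : FiniteProducts C) (X R : C)
    (r : hom R (prod P X X)) : Prop :=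
  let r1 := pi1 P ∘ r in
  let r2 := pi2 P ∘ r in
  (exists rho : hom X R, r ∘ rho = pair P (idm X) (idm X)) /\
  (exists sigma : hom R R, r ∘ sigma = pair P r2 r1) /\
  (exists (Q : C) (p1 p2 : hom Q R) (tau : hom Q R),
     is_weak_pullback r2 r1 p1 p2 /\ r ∘ tau = pair P (r1 ∘ p1) (r2 ∘ p2)).

Record PseudoEquivalence (C : Category) (P : FiniteProducts C) := {
  carrier : C;
  graph : C;
  legs : hom graph (prod P carrier carrier);
  legsP : is_pseudo_equivalence legs
}.

Arguments carrier {C P} _.
Arguments graph {C P} _.
Arguments legs {C P} _.

Section ExactCompletion.

Context {C : Category} {P : FiniteProducts C}.
Implicit Types r s t : PseudoEquivalence P.

Definition tracked r s (f : hom (carrier r) (carrier s)) : Prop :=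
  exists f' : hom (graph r) (graph s), legs s ∘ f' = prod_map P f f ∘ legs r.

Definition identified s (X : C) (f g : hom X (carrier s)) : Prop :=
  exists h : hom X (graph s), legs s ∘ h = pair P f g.

(* Arrows are equivalence classes, represented as subsets of the hom-type. *)
Definition ex_class r s (f : hom (carrier r) (carrier s)) :
    hom (carrier r) (carrier s) -> Prop :=
  fun g => tracked g /\ identified f g.

Definition is_ex_class r s (A : hom (carrier r) (carrier s) -> Prop) : Prop :=
  exists f, tracked f /\ A = ex_class f.

Definition ex_hom r s : Type := { A : hom (carrier r) (carrier s) -> Prop | is_ex_class A }.

Definition ex_mk r s (f : hom (carrier r) (carrier s)) (Hf : tracked f) : ex_hom r s :=
  exist _ (ex_class f) (ex_intro _ f (conj Hf eq_refl)).

Lemma pair_comp (Z W X Y : C) (f : hom Z X) (g : hom Z Y) (h : hom W Z) :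
  pair P f g ∘ h = pair P (f ∘ h) (g ∘ h).
Proof.
rewrite (pair_unique (pair P f g ∘ h)), !comp_assoc, pi1_pair, pi2_pair.
reflexivity.
Qed.

Lemma prod_map_pair (Z X Y X' Y' : C) (a : hom Z X) (b : hom Z Y)
    (f : hom X X') (g : hom Y Y') :
  prod_map P f g ∘ pair P a b = pair P (f ∘ a) (g ∘ b).
Proof.
unfold prod_map; rewrite pair_comp, <- !comp_assoc, pi1_pair, pi2_pair.
reflexivity.
Qed.

Lemma prod_map_id (X Y : C) : prod_map P (idm X) (idm Y) = idm (prod P X Y).
Proof.
unfold prod_map; rewrite (pair_unique (idm (prod P X Y))), !comp_idl, !comp_idr.
reflexivity.
Qed.

Lemma prod_map_comp (X Y X' Y' X'' Y'' : C) (f' : hom X' X'') (g' : hom Y' Y'')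
    (f : hom X X') (g : hom Y Y') :
  prod_map P f' g' ∘ prod_map P f g = prod_map P (f' ∘ f) (g' ∘ g).
Proof.
unfold prod_map at 2; rewrite prod_map_pair, !comp_assoc; reflexivity.
Qed.

Lemma identified_refl s (X : C) (f : hom X (carrier s)) : identified f f.
Proof.
destruct (legsP s) as [[rho Hr] _].
exists (rho ∘ f); rewrite comp_assoc, Hr, pair_comp, comp_idl; reflexivity.
Qed.

Lemma identified_sym s (X : C) (f g : hom X (carrier s)) :
  identified f g -> identified g f.
Proof.
destruct (legsP s) as [_ [[sigma Hs] _]]; intros [h Hh].
exists (sigma ∘ h).
rewrite comp_assoc, Hs, pair_comp, <- !comp_assoc, Hh, pi1_pair, pi2_pair; reflexivity.
Qed.

Lemma identified_trans s (X : C) (f g h : hom X (carrier s)) :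
  identified f g -> identified g h -> identified f h.
Proof.
destruct (legsP s) as [_ [_ [Q [p1 [p2 [tau [[_ HQ] Ht]]]]]]]; intros [a Ha] [b Hb].
destruct (HQ X a b) as [u [Hu1 Hu2]].
{ rewrite <- !comp_assoc, Ha, Hb, pi1_pair, pi2_pair; reflexivity. }
exists (tau ∘ u).
rewrite comp_assoc, Ht, pair_comp, <- !comp_assoc, Hu1, Hu2, Ha, Hb, pi1_pair, pi2_pair.
reflexivity.
Qed.

Lemma identified_precomp s (X Z : C) (f g : hom X (carrier s)) (k : hom Z X) :
  identified f g -> identified (f ∘ k) (g ∘ k).
Proof.
intros [h Hh]; exists (h ∘ k); rewrite comp_assoc, Hh, pair_comp; reflexivity.
Qed.

Lemma identified_postcomp s t (X : C) (f g : hom X (carrier s))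
    (k : hom (carrier s) (carrier t)) :
  tracked k -> identified f g -> identified (k ∘ f) (k ∘ g).
Proof.
intros [k' Hk] [h Hh]; exists (k' ∘ h).
rewrite comp_assoc, Hk, <- comp_assoc, Hh, prod_map_pair; reflexivity.
Qed.

Lemma tracked_id r : tracked (r := r) (s := r) (idm (carrier r)).
Proof.
exists (idm (graph r)); rewrite prod_map_id, comp_idl, comp_idr; reflexivity.
Qed.

Lemma tracked_comp r s t (g : hom (carrier s) (carrier t)) (f : hom (carrier r) (carrier s)) :
  tracked g -> tracked f -> tracked (r := r) (s := t) (g ∘ f).
Proof.
intros [g' Hg] [f' Hf]; exists (g' ∘ f').
rewrite comp_assoc, Hg, <- comp_assoc, Hf, comp_assoc, prod_map_comp; reflexivity.
Qed.

Lemma ex_class_eq r s (f g : hom (carrier r) (carrier s)) :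
  identified f g -> ex_class (r := r) f = ex_class g.
Proof.
intros H; apply functional_extensionality; intros k; apply propositional_extensionality.
split; intros [Hk H']; split; trivial.
- exact (identified_trans (identified_sym H) H').
- exact (identified_trans H H').
Qed.

Lemma ex_hom_eq r s (A B : ex_hom r s) : proj1_sig A = proj1_sig B -> A = B.
Proof.
destruct A as [A HA], B as [B HB]; simpl; intros E; subst B.
rewrite (proof_irrelevance _ HA HB); reflexivity.
Qed.

Lemma ex_mk_eq r s (f g : hom (carrier r) (carrier s)) (Hf : tracked f) (Hg : tracked g) :
  ex_mk Hf = ex_mk Hg <-> identified f g.
Proof.
split.
- intros E; apply (f_equal (fun A => proj1_sig A g)) in E; simpl in E.
  assert (H : ex_class (r := r) g g) by (split; [exact Hg | apply identified_refl]).
  rewrite <- E in H; exact (proj2 H).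
- intros H; apply ex_hom_eq; exact (ex_class_eq H).
Qed.

Lemma ex_mk_surj r s (A : ex_hom r s) :
  exists (f : hom (carrier r) (carrier s)) (Hf : tracked f), A = ex_mk Hf.
Proof.
destruct A as [A [f [Hf E]]]; exists f, Hf; apply ex_hom_eq; exact E.
Qed.

Definition ex_comp_set r s t (B : ex_hom s t) (A : ex_hom r s) :
    hom (carrier r) (carrier t) -> Prop :=
  fun k => tracked k /\
    exists g f, proj1_sig B g /\ proj1_sig A f /\ identified (g ∘ f) k.

Lemma ex_comp_set_mk r s t (g : hom (carrier s) (carrier t)) (f : hom (carrier r) (carrier s))
    (Hg : tracked g) (Hf : tracked f) :
  ex_comp_set (ex_mk Hg) (ex_mk Hf) = ex_class (g ∘ f).
Proof.
apply functional_extensionality; intros k; apply propositional_extensionality.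
split.
- intros [Hk [g0 [f0 [[Hg0 Eg] [[Hf0 Ef] E]]]]]; split; [exact Hk |].
  apply identified_trans with (2 := E).
  apply identified_trans with (g ∘ f0).
  + exact (identified_postcomp Hg Ef).
  + exact (identified_precomp f0 Eg).
- intros [Hk E]; split; [exact Hk |].
  exists g, f; repeat split; trivial; apply identified_refl.
Qed.

Lemma is_ex_class_comp r s t (B : ex_hom s t) (A : ex_hom r s) :
  is_ex_class (ex_comp_set B A).
Proof.
destruct (ex_mk_surj B) as [g [Hg ->]], (ex_mk_surj A) as [f [Hf ->]].
exists (g ∘ f); split; [exact (tracked_comp Hg Hf) | apply ex_comp_set_mk].
Qed.

Definition ex_comp r s t (B : ex_hom s t) (A : ex_hom r s) : ex_hom r t :=
  exist _ (ex_comp_set B A) (is_ex_class_comp B A).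

Lemma ex_comp_mk r s t (g : hom (carrier s) (carrier t)) (f : hom (carrier r) (carrier s))
    (Hg : tracked g) (Hf : tracked f) :
  ex_comp (ex_mk Hg) (ex_mk Hf) = ex_mk (tracked_comp Hg Hf).
Proof. apply ex_hom_eq; apply ex_comp_set_mk. Qed.

Definition ex_id r : ex_hom r r := ex_mk (tracked_id r).

Lemma ex_comp_idl r s (A : ex_hom r s) : ex_comp (ex_id s) A = A.
Proof.
destruct (ex_mk_surj A) as [f [Hf ->]]; unfold ex_id; rewrite ex_comp_mk.
apply ex_mk_eq; rewrite comp_idl; apply identified_refl.
Qed.

Lemma ex_comp_idr r s (A : ex_hom r s) : ex_comp A (ex_id r) = A.
Proof.
destruct (ex_mk_surj A) as [f [Hf ->]]; unfold ex_id; rewrite ex_comp_mk.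
apply ex_mk_eq; rewrite comp_idr; apply identified_refl.
Qed.

Lemma ex_comp_assoc r s t u (D : ex_hom t u) (B : ex_hom s t) (A : ex_hom r s) :
  ex_comp D (ex_comp B A) = ex_comp (ex_comp D B) A.
Proof.
destruct (ex_mk_surj D) as [h [Hh ->]], (ex_mk_surj B) as [g [Hg ->]],
  (ex_mk_surj A) as [f [Hf ->]]; rewrite !ex_comp_mk.
apply ex_mk_eq; rewrite comp_assoc; apply identified_refl.
Qed.

End ExactCompletion.

Definition exact_completion (C : Category) (P : FiniteProducts C) : Category := {|
  ob := PseudoEquivalence P;
  hom := @ex_hom C P;
  idm := @ex_id C P;
  comp := @ex_comp C P;
  comp_idl := @ex_comp_idl C P;
  comp_idr := @ex_comp_idr C P;
  comp_assoc := @ex_comp_assoc C P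
|}.

(* Main.v *)
Require Import Defs.

(** For a pseudo-equivalence relation [s] and [f, g : X -> carrier s], the
    points [x] of [X] at which [f x] and [g x] are related by [s] are the image
    of a weak pullback of [legs s] along [<f, g>]. If that pullback is
    surjective, then a section of it is a witness that [f] and [g] are
    identified.
    So, when every object is a choice object, identification of arrows is tested
    on points. Choosing preimages gives a pointwise inverse of any arrow of the
    exact completion that is bijective on points, and this inverse is tracked
    because that, too, is tested on points.
    Conversely, a surjection [f : X -> Y] induces an arrow from its weak kernel
    pair to [Y], seen as a discrete object, that is bijective on points. Its
    inverse in the exact completion is a section of [f]. *)

Set Implicit Arguments.
Unset Strict Implicit.
Unset Printing Implicit Defensive.
Local Open Scope cat_scope.

(** * Terminal objects and lifting along surjections *)

Lemma terminal_arrow_eq (C : Category) (T X : C) (f g : hom X T) :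
  is_terminal T -> f = g.
Proof.
intros HT; destruct (HT X) as [h [_ Hh]].
rewrite <- (Hh f I); exact (Hh g I).
Qed.

(** [elemental] only provides some terminal object; this moves the property to a chosen one.
    Composing with the unique arrows between [T] and [T'] matches their points. *)
Lemma strong_generator_terminal (C : Category) (T T' : C) :
  is_terminal T -> is_terminal T' -> strong_generator T -> strong_generator T'.
Proof.
intros HT HT' HS X Y f Hf; apply HS; intros y.
destruct (HT T') as [u _], (HT' T) as [v _].
destruct (Hf (y ∘ u)) as [x [Hx Ux]].
assert (Huv : u ∘ v = idm T) by exact (terminal_arrow_eq _ _ HT).
assert (Hvu : v ∘ u = idm T') by exact (terminal_arrow_eq _ _ HT').
exists (x ∘ v); split.
- rewrite comp_assoc, Hx, <- comp_assoc, Huv; apply comp_idr.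
- intros x' Hx'; rewrite (Ux (x' ∘ u)).
  + rewrite <- comp_assoc, Huv; apply comp_idr.
  + rewrite comp_assoc, Hx'; reflexivity.
Qed.

(** The condition on points makes [p1] surjective; following a section of it by [p2] gives the
    lift. *)
Lemma pointwise_lift (C : Category) (T X Y Z : C) (f : hom X Z) (g : hom Y Z)
    (Q : C) (p1 : hom Q X) (p2 : hom Q Y) :
  is_weak_pullback f g p1 p2 -> choice_object T X ->
  (forall x : hom T X, in_image g (f ∘ x)) -> exists h : hom X Y, g ∘ h = f.
Proof.
intros [Hc HQ] HX Him; destruct (HX Q p1) as [s Hs].
- intros x; destruct (Him x) as [y Hy].
  destruct (HQ T x y) as [u [Hu _]]; [symmetry; exact Hy | exists u; exact Hu].
- exists (p2 ∘ s); rewrite comp_assoc, <- Hc, <- comp_assoc, Hs; apply comp_idr.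
Qed.

(** * Weak kernel pairs and diagonals as pseudo-equivalence relations *)

Section Products.

Context {C : Category} (P : FiniteProducts C).

Lemma pair_inj (Z X Y : C) (f f' : hom Z X) (g g' : hom Z Y) :
  pair P f g = pair P f' g' -> f = f' /\ g = g'.
Proof.
intros E; split.
- rewrite <- (pi1_pair P f g), E; apply pi1_pair.
- rewrite <- (pi2_pair P f g), E; apply pi2_pair.
Qed.

Lemma weak_pullback_exists (HE : has_weak_equalisers C) (X Y Z : C)
    (f : hom X Z) (g : hom Y Z) :
  exists (Q : C) (p1 : hom Q X) (p2 : hom Q Y), is_weak_pullback f g p1 p2.
Proof.
destruct (HE _ _ (f ∘ pi1 P) (g ∘ pi2 P)) as [Q [e [Hc HQ]]].
exists Q, (pi1 P ∘ e), (pi2 P ∘ e); split.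
- rewrite !comp_assoc; exact Hc.
- intros W a b Hab; destruct (HQ W (pair P a b)) as [u Hu].
  + rewrite <- !comp_assoc, pi1_pair, pi2_pair; exact Hab.
  + exists u; rewrite <- !comp_assoc, Hu, pi1_pair, pi2_pair; split; reflexivity.
Qed.

Lemma kernel_pseudo_equivalence (HE : has_weak_equalisers C) (X Y : C) (f : hom X Y)
    (R : C) (r : hom R (prod P X X)) :
  is_weak_equaliser (f ∘ pi1 P) (f ∘ pi2 P) r -> is_pseudo_equivalence r.
Proof.
intros [Hc HR].
(* So [r] is the weak kernel pair of [f], and the three structure arrows come from reflexivity,
   symmetry and transitivity of equality after [f]. *)
assert (lift : forall (Z : C) (a b : hom Z X), f ∘ a = f ∘ b ->
  exists u : hom Z R, r ∘ u = pair P a b).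
{ intros Z a b Hab; apply HR; rewrite <- !comp_assoc, pi1_pair, pi2_pair; exact Hab. }
assert (Hr : f ∘ (pi1 P ∘ r) = f ∘ (pi2 P ∘ r)) by (rewrite !comp_assoc; exact Hc).
split; [| split].
- apply lift; reflexivity.
- apply lift; symmetry; exact Hr.
- destruct (weak_pullback_exists HE (pi2 P ∘ r) (pi1 P ∘ r)) as [Q [p1 [p2 HQ]]].
  destruct (lift Q (pi1 P ∘ r ∘ p1) (pi2 P ∘ r ∘ p2)) as [tau Ht].
  + rewrite (comp_assoc f _ p1), Hr, <- (comp_assoc f), (proj1 HQ).
    rewrite !(comp_assoc f _ p2), Hr; reflexivity.
  + exists Q, p1, p2, tau; split; assumption.
Qed.

Lemma discrete_pseudo_equivalence (X : C) :
  is_pseudo_equivalence (pair P (idm X) (idm X)).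
Proof.
unfold is_pseudo_equivalence; rewrite pi1_pair, pi2_pair; split; [| split].
- exists (idm X); apply comp_idr.
- exists (idm X); apply comp_idr.
- exists X, (idm X), (idm X), (idm X); split; [split |].
  + reflexivity.
  + intros W a b; rewrite !comp_idl; intros ->; exists b.
    rewrite comp_idl; split; reflexivity.
  + rewrite !comp_idr; reflexivity.
Qed.

(** The usual embedding of [C] into its exact completion, on objects. *)
Definition discrete (X : C) : PseudoEquivalence P :=
  Build_PseudoEquivalence (discrete_pseudo_equivalence X).

End Products.

(** * Points of the exact completion and identification tested on them *)

Section Points.

Context {C : Category} {P : FiniteProducts C}.
Implicit Types r s : PseudoEquivalence P.

(** Makes tracking a case of identification, so that the test on points covers it too. *)
Lemma tracked_identified r s (f : hom (carrier r) (carrier s)) :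
  tracked f <->
  identified (f ∘ (pi1 P ∘ legs r)) (f ∘ (pi2 P ∘ legs r)).
Proof.
unfold tracked, identified, prod_map.
rewrite pair_comp, <- !comp_assoc; reflexivity.
Qed.

Lemma identified_legs s :
  identified (s := s) (pi1 P ∘ legs s) (pi2 P ∘ legs s).
Proof. exists (idm (graph s)); rewrite comp_idr; apply pair_unique. Qed.

Lemma tracked_discrete (X : C) s (f : hom X (carrier s)) :
  tracked (r := discrete P X) (s := s) f.
Proof.
apply tracked_identified; simpl; rewrite pi1_pair, pi2_pair; apply identified_refl.
Qed.

Lemma identified_discrete (X Z : C) (f g : hom Z X) :
  identified (s := discrete P X) f g -> f = g.
Proof.
intros [h Hh]; simpl in Hh; rewrite pair_comp in Hh.
destruct (pair_inj Hh) as [<- <-]; reflexivity.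
Qed.

Lemma discrete_one_terminal :
  is_terminal (C := exact_completion P) (discrete P (one P)).
Proof.
intros r; destruct (one_terminal P (carrier r)) as [f _].
assert (Hf : tracked (r := r) (s := discrete P (one P)) f).
{ apply tracked_identified; simpl.
  rewrite (terminal_arrow_eq (f ∘ (pi1 P ∘ legs r)) (f ∘ (pi2 P ∘ legs r))
    (one_terminal P)).
  apply identified_refl. }
exists (ex_mk Hf); split; [exact I |]; intros A _.
destruct (ex_mk_surj A) as [g [Hg ->]]; apply ex_mk_eq.
rewrite (terminal_arrow_eq g f (one_terminal P)); apply identified_refl.
Qed.

Definition point s (x : hom (one P) (carrier s)) :
    @hom (exact_completion P) (discrete P (one P)) s :=
  ex_mk (tracked_discrete x).

Lemma point_surj s (A : @hom (exact_completion P) (discrete P (one P)) s) :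
  exists x, A = point x.
Proof.
destruct (ex_mk_surj A) as [x [Hx ->]]; exists x; apply ex_mk_eq, identified_refl.
Qed.

Lemma point_eq s (x y : hom (one P) (carrier s)) :
  point x = point y <-> identified x y.
Proof. apply ex_mk_eq. Qed.

Lemma comp_point r s (f : hom (carrier r) (carrier s)) (Hf : tracked f)
    (x : hom (one P) (carrier r)) :
  @comp (exact_completion P) _ _ _ (ex_mk Hf) (point x) = point (s := s) (f ∘ x).
Proof.
unfold point; simpl; rewrite ex_comp_mk; apply ex_mk_eq, identified_refl.
Qed.

Lemma identified_pointwise (HE : has_weak_equalisers C) s (X : C)
    (f g : hom X (carrier s)) :
  choice_object (one P) X ->
  (forall x : hom (one P) X, identified (f ∘ x) (g ∘ x)) -> identified f g.
Proof.
intros HX Hfg.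
destruct (weak_pullback_exists P HE (pair P f g) (legs s)) as [Q [p1 [p2 HQ]]].
apply (pointwise_lift HQ HX); intros x.
rewrite pair_comp; exact (Hfg x).
Qed.

(** The weak pullback of [prod_map P f g] and [legs s] acts as the object of triples of [x], [y] and
    a witness relating [f x] to [g y]. Its projection to [Y] is surjective, and a section chooses
    [x] and the witness together. *)
Lemma pointwise_preimage (HE : has_weak_equalisers C) s (X Y : C)
    (f : hom X (carrier s)) (g : hom Y (carrier s)) :
  choice_object (one P) Y ->
  (forall y : hom (one P) Y, exists x : hom (one P) X, identified (f ∘ x) (g ∘ y)) ->
  exists k : hom Y X, identified (f ∘ k) g.
Proof.
intros HY Hfg.
destruct (weak_pullback_exists P HE (prod_map P f g) (legs s)) as [Q [p [q [Hc HQ]]]].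
destruct (HY Q (pi2 P ∘ p)) as [t Ht].
- intros y; destruct (Hfg y) as [x [h Hh]].
  destruct (HQ (one P) (pair P x y) h) as [u [Hu _]].
  + rewrite prod_map_pair, Hh; reflexivity.
  + exists u; rewrite <- comp_assoc, Hu; apply pi2_pair.
- exists (pi1 P ∘ p ∘ t), (q ∘ t); unfold is_section in Ht.
  rewrite comp_assoc, <- Hc; unfold prod_map; rewrite !pair_comp, <- !comp_assoc.
  rewrite (comp_assoc (pi2 P)), Ht, comp_idr; reflexivity.
Qed.

Lemma exact_completion_separating (HE : has_weak_equalisers C) :
  (forall Y : C, choice_object (one P) Y) ->
  separating (C := exact_completion P) (discrete P (one P)).
Proof.
intros HC r s A B HAB.
destruct (ex_mk_surj A) as [f [Hf ->]], (ex_mk_surj B) as [g [Hg ->]].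
apply ex_mk_eq, (identified_pointwise HE); [apply HC | intros x].
apply point_eq; rewrite <- (comp_point Hf), <- (comp_point Hg); apply HAB.
Qed.

Lemma exact_completion_strong_generator (HE : has_weak_equalisers C) :
  (forall Y : C, choice_object (one P) Y) ->
  strong_generator (C := exact_completion P) (discrete P (one P)).
Proof.
intros HC r s A HA; destruct (ex_mk_surj A) as [f [Hf ->]].
(* Uniqueness of preimages: [point x] and [point x'] both lie over [point (f ∘ x')]. *)
assert (inj : forall x x' : hom (one P) (carrier r),
  identified (f ∘ x) (f ∘ x') -> identified x x').
{ intros x x' Hx; apply point_eq.
  destruct (HA (point (f ∘ x'))) as [z [_ Uz]].
  rewrite <- (Uz (point x)), <- (Uz (point x')); [reflexivity | |];
    rewrite comp_point; [reflexivity | apply point_eq; exact Hx]. }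
(* Preimages of the identity give a right inverse of [f] up to identification. *)
destruct (@pointwise_preimage HE s _ _ f (idm (carrier s))) as [g Hfg].
{ apply HC. }
{ intros y; destruct (HA (point y)) as [z [Hz _]].
  destruct (point_surj z) as [x ->]; exists x.
  rewrite comp_point in Hz; rewrite comp_idl; apply point_eq; exact Hz. }
assert (Hfgx : forall X (x : hom X (carrier s)), identified (f ∘ (g ∘ x)) x).
{ intros X x; apply (identified_precomp x) in Hfg.
  rewrite comp_idl, <- comp_assoc in Hfg; exact Hfg. }
assert (Hg : tracked (r := s) (s := r) g).
(* By [inj] the two sides may be compared after [f], where [f ∘ g] cancels and only the legs of [s]
   remain. *)
{ apply tracked_identified, (identified_pointwise HE); [apply HC | intros z].
  apply inj; rewrite <- !(comp_assoc g).
  apply (identified_trans (Hfgx _ _)).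
  apply (fun H => identified_trans H (identified_sym (Hfgx _ _))).
  apply identified_precomp, identified_legs. }
exists (ex_mk Hg); simpl; rewrite !ex_comp_mk; split; apply ex_mk_eq.
- apply (identified_pointwise HE); [apply HC | intros x].
  apply inj; rewrite comp_idl, <- comp_assoc; apply Hfgx.
- exact Hfg.
Qed.

Lemma choice_of_strong_generator (HE : has_weak_equalisers C) :
  strong_generator (C := exact_completion P) (discrete P (one P)) ->
  forall Y : C, choice_object (one P) Y.
Proof.
intros HS Y X f Hsurj.
destruct (HE _ _ (f ∘ pi1 P) (f ∘ pi2 P)) as [R [e He]].
pose (k := Build_PseudoEquivalence (kernel_pseudo_equivalence HE He)).
assert (Hf : tracked (r := k) (s := discrete P Y) f).
{ apply tracked_identified; simpl.
  rewrite !comp_assoc, (proj1 He); apply identified_refl. }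
destruct (HS _ _ (ex_mk Hf)) as [B [_ HB]].
(* Surjectivity of [f] gives a preimage; it is unique because [k] relates any two points with equal
   values under [f]. *)
- intros A; destruct (point_surj A) as [y ->], (Hsurj y) as [x Hx].
  exists (point (s := k) x); split.
  + rewrite comp_point; apply point_eq.
    simpl; rewrite Hx; apply identified_refl.
  + intros A' HA'; destruct (point_surj A') as [x' ->].
    rewrite comp_point in HA'; apply point_eq in HA'; apply identified_discrete in HA'.
    apply point_eq, (proj2 He).
    rewrite <- !comp_assoc, pi1_pair, pi2_pair; exact (eq_trans Hx (eq_sym HA')).
(* Identification in a discrete object is equality, so a representative of the inverse is a strict
   section. *)
- destruct (ex_mk_surj B) as [s [Hs ->]]; exists s.
  simpl in HB; rewrite ex_comp_mk in HB; apply ex_mk_eq in HB.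
  exact (identified_discrete HB).
Qed.

End Points.

Theorem theorem3p12 (C : Category) (P : FiniteProducts C)
    (HE : has_weak_equalisers C) :
  elemental (exact_completion P) <-> forall Y : C, choice_object (one P) Y.
Proof.
split.
- intros [T [HT [HS _]]]; apply (choice_of_strong_generator HE).
  exact (strong_generator_terminal HT discrete_one_terminal HS).
- intros HC; exists (discrete P (one P)); split; [| split].
  + exact discrete_one_terminal.
  + exact (exact_completion_strong_generator HE HC).
  + exact (exact_completion_separating HE HC).
Qed.
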